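(* Let $k,l\ge 1$, $n=k+l$, and let $$H=\begin{pmatrix} A & B\\ B^\star & C\end{pmatrix}\in M_n(\mathbb{C}),\qquad A\in M_k(\mathbb{C}),\ C\in M_l(\mathbb{C}),$$ be Hermitian and positive semidefinite. If $H$ is of maximal rank, then $${\det}_+ H={\det}_+ (A)\;\,{\det}_+ (H/A),$$ where $H/A=C-B^\star A^+B$ is the (generalized) Schur complement of $A$ in $H$.
   Context: $B^\star$ denotes the conjugate transpose of $B$, $A^+$ the Moore-Penrose inverse of $A$; $N(M)$ and $R(M)$ denote the nullspace and range of a matrix $M$. Maximal rank: the positive semidefinite Hermitian matrix $H=\begin{pmatrix} A & B\\ B^\star & C\end{pmatrix}$ is of maximal rank (with respect to this partition) if $N(H)=N(A)\oplus N(C)$; equivalently, $\operatorname{rank}H=\operatorname{rank}A+\operatorname{rank}C$. Generalized determinant: for a nonzero Hermitian matrix $M$, ${\det}_+ M$ is the determinant of the linear map $M|_{R(M)}:R(M)\to R(M)$; for $M=0$, ${\det}_+ M=1$. *)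

(* Defs.v *)
From HB Require Import structures.
From mathcomp Require Import all_boot all_order all_algebra.
From mathcomp Require Import sesquilinear spectral.
From mathcomp Require Import boolp classical_sets reals.
From mathcomp Require Import complex.

Set Implicit Arguments.
Unset Strict Implicit.
Unset Printing Implicit Defensive.

Import Order.TTheory GRing.Theory Num.Theory.

Local Open Scope classical_set_scope.
Local Open Scope ring_scope.
Local Open Scope sesquilinear_scope.

(* Matrices act on column vectors: x |-> M *m x.  The conjugate transpose of
   M is the library's M ^t*. *)

Section Definitions.
Variable C : numClosedFieldType.

(* In a numClosedFieldType, 0 <= z says that z is real and nonnegative. *)
Definition psdmx n (M : 'M[C]_n) : Prop :=
  M \is hermsymmx /\ forall x : 'cV[C]_n, 0 <= (x ^t* *m M *m x) 0 0.

Definition nullspace m n (M : 'M[C]_(m, n)) : set 'cV[C]_n :=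
  [set x | M *m x = 0].

(* N(H) = N(A) (+) N(D), for the diagonal blocks A and D of H, where N(A) is
   embedded in the first k coordinates and N(D) in the last l ones. *)
Definition maximal_rank k l (H : 'M[C]_(k + l)) : Prop :=
  nullspace H =
  [set col_mx x y | x in nullspace (ulsubmx H) & y in nullspace (drsubmx H)].

Definition is_mp_inverse m n (A : 'M[C]_(m, n)) (X : 'M[C]_(n, m)) : Prop :=
  [/\ A *m X *m A = A, X *m A *m X = X,
      (A *m X) ^t* = A *m X & (X *m A) ^t* = X *m A].

(* The default value 0 is never used, see mp_inverseP. *)
Definition mp_inverse m n (A : 'M[C]_(m, n)) : 'M[C]_(n, m) :=
  xget 0 [set X | is_mp_inverse A X].

Definition schur_complement k l (A : 'M[C]_k) (B : 'M[C]_(k, l))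
    (D : 'M[C]_l) : 'M[C]_l :=
  D - B ^t* *m mp_inverse A *m B.

(* The library's restrictmx V f is the matrix, in the basis row_base V, of
   the map v |-> v *m f restricted to the row space of V.  Transposing, this is
   the matrix of x |-> M *m x restricted to the column space R(M).  For M = 0
   this is a 0 x 0 matrix, with determinant 1. *)
Definition det_plus n (M : 'M[C]_n) : C := \det (restrictmx M^T M^T).

End Definitions.

Section Facts.
Variable C : numClosedFieldType.

Lemma adjmxM m n p (A : 'M[C]_(m, n)) (B : 'M[C]_(n, p)) :
  (A *m B) ^t* = B ^t* *m A ^t*.
Proof. by rewrite trmx_mul map_mxM. Qed.

Lemma mul_adjmx_eq0 m n (A : 'M[C]_(m, n)) : A *m A ^t* = 0 -> A = 0.
Proof.
move=> A0; apply/matrixP => i j; rewrite mxE.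
have /matrixP /(_ i i) := A0; rewrite !mxE => /eqP.
rewrite psumr_eq0; last by move=> k _; rewrite !mxE mul_conjC_ge0.
move=> /allP /(_ j (mem_index_enum _)) /=.
by rewrite !mxE mul_conjC_eq0 => /eqP.
Qed.

Lemma row_free_gram m n (A : 'M[C]_(m, n)) :
  row_free A -> A *m A ^t* \in unitmx.
Proof.
move=> fA; rewrite -row_free_unit -kermx_eq0 -(mulmx_free_eq0 _ fA); apply/eqP.
apply: mul_adjmx_eq0.
by rewrite adjmxM mulmxA -(mulmxA _ A) mulmx_ker mul0mx.
Qed.

Lemma full_rank_mp_inverse m n r (F : 'M[C]_(m, r)) (G : 'M[C]_(r, n)) :
  row_full F -> row_free G ->
  is_mp_inverse (F *m G)
    (G ^t* *m invmx (G *m G ^t*) *m (invmx (F ^t* *m F) *m F ^t*)).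
Proof.
move=> fF fG; have uG := row_free_gram fG.
have uF : F ^t* *m F \in unitmx.
  rewrite -[F in X in _ *m X]trmxCK row_free_gram //.
  by rewrite /row_free mxrank_map mxrank_tr.
set P := G ^t* *m _; set Q := invmx _ *m _.
have GP : G *m P = 1%:M by rewrite mulmxA mulmxV.
have QF : Q *m F = 1%:M by rewrite -mulmxA mulVmx.
have adjV (U : 'M[C]_r) : (invmx U) ^t* = invmx (U ^t*).
  by rewrite trmx_inv map_invmx.
have AX : F *m G *m (P *m Q) = F *m Q.
  by rewrite -mulmxA (mulmxA G) GP mul1mx.
have XA : P *m Q *m (F *m G) = P *m G.
  by rewrite -mulmxA (mulmxA Q) QF mul1mx.
split.
- by rewrite AX -mulmxA (mulmxA Q) QF mul1mx.
- by rewrite XA -mulmxA (mulmxA G) GP mul1mx.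
- by rewrite AX /Q !adjmxM adjV adjmxM trmxCK mulmxA.
- by rewrite XA /P !adjmxM adjV adjmxM trmxCK mulmxA.
Qed.

Lemma mp_inverse_exists m n (A : 'M[C]_(m, n)) : exists X, is_mp_inverse A X.
Proof.
have := full_rank_mp_inverse (col_base_full A) (row_base_free A).
by rewrite mulmx_base => AX; eexists; exact: AX.
Qed.

Lemma mp_inverseP m n (A : 'M[C]_(m, n)) : is_mp_inverse A (mp_inverse A).
Proof. exact: (xgetPex _ (mp_inverse_exists A)). Qed.

Lemma is_mp_inverse_unique m n (A : 'M[C]_(m, n)) X Y :
  is_mp_inverse A X -> is_mp_inverse A Y -> X = Y.
Proof.
move=> [X1 X2 X3 X4] [Y1 Y2 Y3 Y4].
have AXY : A *m X = A *m Y.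
  rewrite -[RHS]Y3 -[in RHS]X1 -(mulmxA _ A) adjmxM X3 Y3.
  by rewrite mulmxA Y1.
have XAY : X *m A = Y *m A.
  rewrite -[RHS]Y4 -[in RHS]X1 -(mulmxA A) mulmxA adjmxM X4 Y4.
  by rewrite -mulmxA (mulmxA A) Y1.
by rewrite -X2 XAY -mulmxA AXY mulmxA Y2.
Qed.

Lemma det_plus0 n : det_plus (0 : 'M[C]_n) = 1.
Proof.
rewrite /det_plus; move: (restrictmx _ _); rewrite trmx0 mxrank0 => M.
exact: det_mx00.
Qed.

Lemma det_plusE n (M : 'M[C]_n) (F : 'M[C]_(n, \rank M^T))
    (X : 'M[C]_(\rank M^T)) :
  (F^T :=: M^T)%MS -> M *m F = F *m X -> det_plus M = \det X.
Proof.
move=> eqFM MF; rewrite /det_plus; set P := row_base M^T.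
have fP : row_free P by apply: row_base_free.
have [Q FE] : exists Q, F^T = Q *m P.
  by apply/submxP; rewrite eqFM eq_row_base.
have uQ : Q \in unitmx.
  rewrite -row_free_unit /row_free eqn_leq rank_leq_row /=.
  by rewrite -{1}eqFM FE mxrankM_maxl.
have PM : conjmx P M^T *m P = P *m M^T.
  by rewrite mulmxKpV // stablemx_row_base submxMl.
have QX : Q *m conjmx P M^T *m P = X^T *m Q *m P.
  by rewrite -(mulmxA Q (conjmx P M^T)) PM mulmxA -FE -(mulmxA X^T) -FE -!trmx_mul MF.
have := congr1 (fun Y => \det Y) (row_free_inj fP QX).
rewrite !det_mulmx det_tr mulrC.
by move=> /mulIf; apply; rewrite -unitfE -unitmxE.
Qed.

End Facts.

(* Main.v *)
Require Import Defs.
From mathcomp Require Import all_boot all_order all_algebra.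
From mathcomp Require Import sesquilinear spectral.
From mathcomp Require Import reals complex.

(** Since N(A) (+) N(C) is contained in N(H), B vanishes on N(C) and B^*
    vanishes on N(A).  Let the rows of F and G be bases of the row spaces of A
    and C.  As A and C are Hermitian, all four blocks then factor through F
    and G ([sandwich_factor]):
      A = F^* a F,   B = F^* b G,   C = G^* c G,
    so that H = D^* h D, where D = diag(F, G) and h is the small matrix with
    blocks a, b, b^*, c.  The rest of the maximal rank condition, that N(H) is
    no larger than N(A) (+) N(C) = N(D), makes h invertible
    ([core_unitmx]).

    For an invertible core m and independent rows P, the matrix P^* m P has
    generalized determinant det m * det (P P^* ) ([det_plus_congr]).  Moreover
    F A^+ F^* = a^-1, hence H/A = G^* (c - b^* a^-1 b) G: the core of the Schur
    complement is the ordinary Schur complement of the cores.  The claim thus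
    reduces to the classical formula det h = det a * det (c - b^* a^-1 b)
    ([det_schur]), together with
    det (D D^* ) = det (F F^* ) * det (G G^* ). *)

Set Implicit Arguments.
Unset Strict Implicit.
Unset Printing Implicit Defensive.

Import GRing.Theory.

Local Open Scope ring_scope.
Local Open Scope sesquilinear_scope.

Section GeneralizedDeterminant.
Variable K : numClosedFieldType.

Lemma row_full_adjmx m n (P : 'M[K]_(m, n)) : row_full (P ^t*) = row_free P.
Proof. by rewrite /row_full /row_free mxrank_map mxrank_tr. Qed.

Lemma row_full_trmx m n (P : 'M[K]_(m, n)) : row_full P^T = row_free P.
Proof. by rewrite /row_full /row_free mxrank_tr. Qed.

Lemma adjmx_block m1 m2 n1 n2 (A : 'M[K]_(m1, n1)) (B : 'M[K]_(m1, n2))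
    (C : 'M[K]_(m2, n1)) (D : 'M[K]_(m2, n2)) :
  (block_mx A B C D) ^t* = block_mx (A ^t*) (C ^t*) (B ^t*) (D ^t*).
Proof. by rewrite tr_block_mx map_block_mx. Qed.

(** The Gram matrix gives a preimage: P sends P^* (P P^* )^-1 v to v. *)
Lemma row_free_surj m n p (P : 'M[K]_(m, n)) (v : 'M[K]_(m, p)) :
  row_free P -> exists x, P *m x = v.
Proof.
move=> /row_free_gram uP; exists (P ^t* *m (invmx (P *m P ^t*) *m v)).
by rewrite mulmxA mulKVmx.
Qed.

(** Row spaces are the annihilators of nullspaces; it is enough to test on the
    columns of the cokernel of Y. *)
Lemma submx_nullspace m p n (X : 'M[K]_(m, n)) (Y : 'M[K]_(p, n)) :
  (forall x : 'cV[K]_n, Y *m x = 0 -> X *m x = 0) -> (X <= Y)%MS.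
Proof.
move=> sYX; rewrite submxE; apply/eqP/matrixP => i j.
have /matrixP /(_ i 0) : X *m col j (cokermx Y) = 0.
  by apply: sYX; rewrite colE mulmxA mulmx_coker mul0mx.
by rewrite !colE mulmxA -colE !mxE.
Qed.

(** The inclusion of the row spaces of X and X^* in those of G and F lets one
    peel off G on the right and F^* on the left. *)
Lemma sandwich_factor m n p q (X : 'M[K]_(m, n)) (F : 'M[K]_(p, m))
    (G : 'M[K]_(q, n)) :
  row_free F -> (X <= G)%MS -> (X ^t* <= F)%MS ->
  exists x : 'M[K]_(p, q), X = F ^t* *m x *m G.
Proof.
move=> fF /submxP [Y XY] /submxP [Z XZ].
have uF := row_free_gram fF.
have XFZ : X = F ^t* *m Z ^t* by rewrite -adjmxM -XZ trmxCK.
exists (invmx (F *m F ^t*) *m (F *m Y)).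
(* The product is the orthogonal projection F^* (F F^* )^-1 F onto the range
   of F^*, applied to X, and X already has its columns in that range. *)
have -> : F ^t* *m (invmx (F *m F ^t*) *m (F *m Y)) *m G
  = F ^t* *m (invmx (F *m F ^t*) *m (F *m X)) by rewrite XY !mulmxA.
by rewrite {2}XFZ (mulmxA F) mulKmx.
Qed.

(** A Hermitian matrix has conjugate row and column spaces, so one basis F serves
    on both sides; comparing ranks, the core is invertible. *)
Lemma hermitian_core n (A : 'M[K]_n) : A ^t* = A ->
  exists r (F : 'M[K]_(r, n)) a,
    [/\ row_free F, (F :=: A)%MS, a \in unitmx & A = F ^t* *m a *m F].
Proof.
move=> hA; exists (\rank A), (row_base A).
have sAF : (A <= row_base A)%MS by rewrite eq_row_base.
have [|a Aa] := sandwich_factor (row_base_free A) sAF; first by rewrite hA.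
exists a; split=> //; rewrite ?row_base_free //; first exact: eq_row_base.
rewrite -row_free_unit /row_free eqn_leq rank_leq_row /=.
rewrite {1}Aa -mulmxA; apply: leq_trans (mxrankM_maxr _ _) _.
exact: mxrankM_maxl.
Qed.

(** The columns of P^* are a basis of the range of P^* a P, and in this basis
    the matrix acts as a (P P^* ). *)
Lemma det_plus_congr m n (P : 'M[K]_(m, n)) (a : 'M[K]_m) :
  row_free P -> a \in unitmx ->
  det_plus (P ^t* *m a *m P) = \det a * \det (P *m P ^t*).
Proof.
move=> fP ua; rewrite -det_mulmx; set M := _ *m P.
have eqPM : ((P ^t*)^T :=: M^T)%MS.
  apply: eqmx_sym; rewrite /M !trmx_mul mulmxA.
  apply: eqmxMfull; rewrite -trmx_mul row_full_trmx.
  by rewrite /row_free mxrankMfree ?mxrank_unit.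
have MP : M *m P ^t* = P ^t* *m (a *m (P *m P ^t*)) by rewrite /M !mulmxA.
have rM : m = \rank M^T.
  by rewrite -eqPM mxrank_tr mxrank_map mxrank_tr (eqP fP).
move: (P ^t*) (a *m _) eqPM MP; clearbody M; move: rM; clear.
by move=> -> Q X; apply: det_plusE.
Qed.

Lemma det_schur r s (a : 'M[K]_r) (b : 'M[K]_(r, s)) (c : 'M[K]_(s, r))
    (d : 'M[K]_s) :
  a \in unitmx ->
  \det (block_mx a b c d) = \det a * \det (d - c *m invmx a *m b).
Proof.
move=> ua.
have -> : block_mx a b c d = block_mx 1%:M 0 (c *m invmx a) 1%:M
    *m block_mx a b 0 (d - c *m invmx a *m b).
  rewrite mulmx_block !mul1mx !mul0mx !addr0 mulmxKV //.
  by rewrite addrC subrK.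
by rewrite det_mulmx det_lblock det_ublock !det1 !mul1r.
Qed.

(** Every column is of the form D x; if h kills it then D^* h D kills x, and so
    does D. *)
Lemma core_unitmx m n (D : 'M[K]_(m, n)) (h : 'M[K]_m) :
  row_free D ->
  (forall x : 'cV[K]_n, D ^t* *m h *m D *m x = 0 -> D *m x = 0) ->
  h \in unitmx.
Proof.
move=> fD inj; rewrite -unitmx_tr -row_free_unit; apply: inj_row_free => v vh0.
have hv0 : h *m v^T = 0 by rewrite -[h]trmxK -trmx_mul vh0 trmx0.
have [x Dx] := row_free_surj v^T fD.
apply: trmx_inj; rewrite trmx0 -Dx; apply: inj.
by rewrite -!mulmxA Dx hv0 mulmx0.
Qed.

(** Cancelling F^* and F in A A^+ A = A leaves a (F A^+ F^* ) a = a. *)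
Lemma core_mp_inverse r n (F : 'M[K]_(r, n)) (a : 'M[K]_r) (X : 'M[K]_n) :
  row_free F -> a \in unitmx -> is_mp_inverse (F ^t* *m a *m F) X ->
  F *m X *m F ^t* = invmx a.
Proof.
move=> fF ua [AXA _ _ _].
have fF' : row_full (F ^t*) by rewrite row_full_adjmx.
have E : a *m (F *m X *m F ^t*) *m a = a.
  apply: (row_free_inj fF); apply: (row_full_inj fF').
  by rewrite !mulmxA in AXA *.
by rewrite -[LHS](mulKmx ua) -[a *m _](mulmxK ua) E mulmxV // mulmx1.
Qed.

Lemma det_plus_schur k l (A : 'M[K]_k) (B : 'M[K]_(k, l)) (C : 'M[K]_l) :
  (block_mx A B (B ^t*) C) ^t* = block_mx A B (B ^t*) C ->
  maximal_rank (block_mx A B (B ^t*) C) ->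
  det_plus (block_mx A B (B ^t*) C) =
  det_plus A * det_plus (schur_complement A B C).
Proof.
rewrite adjmx_block => /eq_block_mx [hA _ _ hC].
rewrite /maximal_rank block_mxKul block_mxKdr => NH.
have NH1 (x : 'cV_k) (y : 'cV_l) :
    A *m x = 0 -> C *m y = 0 -> B *m y = 0 /\ B ^t* *m x = 0.
  move=> Ax0 Cy0.
  have : nullspace (block_mx A B (B ^t*) C) (col_mx x y).
    by rewrite NH; exists x => //; exists y.
  rewrite /nullspace /= mul_block_col Ax0 Cy0 add0r addr0 => E.
  by move: E; rewrite -[RHS]col_mx0 => /eq_col_mx.
have sBC : (B <= C)%MS.
  by apply: submx_nullspace => y /(NH1 0 y (mulmx0 _ _)) [].
have sBA : (B ^t* <= A)%MS.
  by apply: submx_nullspace => x /NH1 /(_ (mulmx0 _ _)) [].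
have [r [F [a [fF FA ua Aa]]]] := hermitian_core hA.
have [s [G [c [fG GC _ Cc]]]] := hermitian_core hC.
have [||b Bb] := @sandwich_factor _ _ _ _ B F G fF; rewrite ?FA ?GC //.
have Bb' : B ^t* = G ^t* *m b ^t* *m F.
  by rewrite {1}Bb !adjmxM trmxCK mulmxA.
pose D := block_mx F 0 0 G; pose h := block_mx a b (b ^t*) c.
have DE : D ^t* = block_mx (F ^t*) 0 0 (G ^t*).
  by rewrite adjmx_block !trmx0 !map_mx0.
have HE : block_mx A B (B ^t*) C = D ^t* *m h *m D.
  rewrite DE /D /h !mulmx_block !mul0mx !mulmx0 !addr0 !add0r.
  by rewrite -Aa -Bb -Bb' -Cc.
have fD : row_free D.
  apply: inj_row_free => v; rewrite -[v]hsubmxK mul_row_block !mulmx0.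
  rewrite addr0 add0r -row_mx0 => /eq_row_mx [/eqP + /eqP].
  by rewrite !mulmx_free_eq0 // => /eqP -> /eqP ->; rewrite row_mx0.
have kerF x : A *m x = 0 -> F *m x = 0.
  by have /submxP [Z ->] : (F <= A)%MS; rewrite ?FA // => Ax0;
    rewrite -mulmxA Ax0 mulmx0.
have kerG y : C *m y = 0 -> G *m y = 0.
  by have /submxP [Z ->] : (G <= C)%MS; rewrite ?GC // => Cy0;
    rewrite -mulmxA Cy0 mulmx0.
have uh : h \in unitmx.
  apply: (core_unitmx fD) => z; rewrite -HE => Hz0.
  have : nullspace (block_mx A B (B ^t*) C) z by [].
  rewrite NH => -[x /kerF Fx0 [y /kerG Gy0 <-]].
  by rewrite mul_block_col Fx0 Gy0 !mul0mx !addr0 col_mx0.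
have SE : schur_complement A B C = G ^t* *m (c - b ^t* *m invmx a *m b) *m G.
  have AX := mp_inverseP A; rewrite {1}Aa in AX.
  rewrite /schur_complement -(core_mp_inverse fF ua AX) Bb'.
  by rewrite Bb Cc mulmxBr mulmxBl !mulmxA.
have us : c - b ^t* *m invmx a *m b \in unitmx.
  by move: uh; rewrite !unitmxE det_schur // unitrM => /andP [].
rewrite HE SE [in RHS]Aa !det_plus_congr // det_schur // DE mulmx_block.
rewrite !mulmx0 !mul0mx !addr0 !add0r det_ublock.
exact: mulrACA.
Qed.

End GeneralizedDeterminant.

Theorem proposition4p2 (R : realType) (k l : nat)
    (hk : (1 <= k)%N) (hl : (1 <= l)%N)
    (A : 'M[R[i]]_k) (B : 'M[R[i]]_(k, l)) (C : 'M[R[i]]_l)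
    (H : 'M[R[i]]_(k + l)) (HE : H = block_mx A B (B ^t*) C)
    (Hpsd : psdmx H) (Hmax : maximal_rank H) :
  det_plus H = det_plus A * det_plus (schur_complement A B C).
Proof.
case: Hpsd => /is_hermitianmxP; rewrite expr0 scale1r => hH _; subst H.
by apply: det_plus_schur.
Qed.
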